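(* The locale map $c\colon2^\omega\to\mathbb{I}$ is the coequalizer, in the category of locales, of the two maps $u_+,u_-\colon2^\ast\rightrightarrows2^\omega$.
   Context: Write $2=\{-,+\}$ (discrete). Cantor space $2^\omega$ is the locale of streams (indexed by $1,2,3,\dots$) of signs; $2^\ast$ is the set of finite sign sequences, regarded as a discrete locale; juxtaposition denotes concatenation. $\mathbb{I}=[-1,1]$ is the locale of Dedekind reals in the closed interval. The map $c\colon 2^\omega\to\mathbb{I}$ is the unique locale map with $c(\pm s)=\frac12(\pm1+c(s))$; on streams, $c((s_i)_{i\ge1})=\sum_{i\ge1}s_i2^{-i}$, where $\pm$ is read as $\pm1$. Let $0_-=+-^\omega$ and $0_+=-+^\omega$ in $2^\omega$ (a single sign followed by the constant stream of the other sign). The maps $u_\pm\colon2^\ast\to2^\omega$ are defined by $u_\pm(s)=s0_\pm$. *)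

(* Defs.v *)
From mathcomp Require Import all_boot all_order all_algebra.
From mathcomp Require Import boolp classical_sets.
From mathcomp Require Import ring lra zify.

Set Implicit Arguments.
Unset Strict Implicit.
Unset Printing Implicit Defensive.

Import Order.TTheory GRing.Theory Num.Theory.

Local Open Scope classical_set_scope.
Local Open Scope ring_scope.

Record locale := Locale {
  opens : Type;
  ole : opens -> opens -> Prop;
  otop : opens;
  omeet : opens -> opens -> opens;
  osup : set opens -> opens;
  ole_refl : forall U, ole U U;
  ole_trans : forall U V W, ole U V -> ole V W -> ole U W;
  ole_anti : forall U V, ole U V -> ole V U -> U = V;
  ole_top : forall U, ole U otop;
  ole_meet : forall U V W, ole W (omeet U V) <-> ole W U /\ ole W V;
  osup_le : forall S W, ole (osup S) W <-> (forall U, S U -> ole U W);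
  omeet_sup : forall U S, omeet U (osup S) = osup [set omeet U V | V in S]
}.

Arguments otop {l} : simpl never.
Arguments ole {l} U V : simpl never, rename.
Arguments omeet {l} U V : simpl never, rename.
Arguments osup {l} S : simpl never, rename.

(* A map of locales X -> Y is a frame homomorphism opens Y -> opens X. *)
Record locmap (X Y : locale) := LocMap {
  inv_im :> opens Y -> opens X;
  inv_im_top : inv_im otop = otop;
  inv_im_meet : forall U V, inv_im (omeet U V) = omeet (inv_im U) (inv_im V);
  inv_im_sup : forall S, inv_im (osup S) = osup [set inv_im V | V in S]
}.

Lemma locmap_ext (X Y : locale) (f g : locmap X Y) :
  (forall U, f U = g U) -> f = g.
Proof.
case: f g => [f f1 f2 f3] [g g1 g2 g3] /= /funext fg.
by subst g; congr LocMap; exact: Prop_irrelevance.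
Qed.

Definition locid (X : locale) : locmap X X.
Proof. by refine (@LocMap X X id _ _ _) => // S; rewrite image_id. Defined.

Definition loccomp (X Y Z : locale) (g : locmap Y Z) (f : locmap X Y) :
  locmap X Z.
Proof.
refine (@LocMap X Z (fun U => f (g U)) _ _ _).
- by rewrite !inv_im_top.
- by move=> U V; rewrite !inv_im_meet.
- by move=> S; rewrite !inv_im_sup image_comp.
Defined.

Notation "g \oL f" := (loccomp g f) (at level 50, left associativity).

Lemma locidE (X : locale) (U : opens X) : locid X U = U.
Proof. by []. Qed.

Lemma loccompE (X Y Z : locale) (g : locmap Y Z) (f : locmap X Y) U :
  (g \oL f) U = f (g U).
Proof. by []. Qed.

Definition is_coequalizer (A X Y : locale) (f g : locmap A X)
    (e : locmap X Y) : Prop :=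
  e \oL f = e \oL g /\
  forall (Z : locale) (h : locmap X Z), h \oL f = h \oL g ->
    exists! k : locmap Y Z, k \oL e = h.

Section LocaleTheory.
Variable X : locale.
Implicit Types (U V W : opens X) (S : set (opens X)).

Lemma omeet_lel U V : ole (omeet U V) U.
Proof. by have /ole_meet[] := ole_refl (omeet U V). Qed.

Lemma omeet_ler U V : ole (omeet U V) V.
Proof. by have /ole_meet[] := ole_refl (omeet U V). Qed.

Lemma ole_omeet U V W : ole W U -> ole W V -> ole W (omeet U V).
Proof. by move=> WU WV; apply/ole_meet. Qed.

Lemma ole_sup S U : S U -> ole U (osup S).
Proof. by move: U; apply/osup_le/ole_refl. Qed.

Lemma omeet_mono U U' V V' :
  ole U U' -> ole V V' -> ole (omeet U V) (omeet U' V').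
Proof.
move=> UU VV; apply: ole_omeet.
- exact: ole_trans (omeet_lel _ _) UU.
- exact: ole_trans (omeet_ler _ _) VV.
Qed.

Lemma omeetC U V : omeet U V = omeet V U.
Proof.
by apply: ole_anti; apply: ole_omeet;
  (exact: omeet_ler || exact: omeet_lel).
Qed.

Lemma omeetA U V W : omeet U (omeet V W) = omeet (omeet U V) W.
Proof.
apply: ole_anti.
- apply: ole_omeet; first exact: omeet_mono (ole_refl _) (omeet_lel _ _).
  exact: ole_trans (omeet_ler _ _) (omeet_ler _ _).
- apply: ole_omeet; first exact: ole_trans (omeet_lel _ _) (omeet_lel _ _).
  exact: omeet_mono (omeet_ler _ _) (ole_refl _).
Qed.

Lemma omeetUU U : omeet U U = U.
Proof.
apply: ole_anti; first exact: omeet_lel.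
by apply: ole_omeet; exact: ole_refl.
Qed.

Lemma omeetT U : omeet U otop = U.
Proof.
apply: ole_anti; first exact: omeet_lel.
by apply: ole_omeet; [exact: ole_refl|exact: ole_top].
Qed.

Lemma omeetTl U : omeet otop U = U.
Proof. by rewrite omeetC omeetT. Qed.

Lemma ole_omeetE U V : ole U V -> omeet U V = U.
Proof.
move=> UV; apply: ole_anti; first exact: omeet_lel.
by apply: ole_omeet => //; exact: ole_refl.
Qed.

Lemma osup0_le U : ole (osup set0) U.
Proof. by apply/osup_le. Qed.

Lemma omeet_sup_le U S W :
  (forall V, S V -> ole (omeet U V) W) -> ole (omeet U (osup S)) W.
Proof.
by move=> H; rewrite omeet_sup; apply/osup_le => _ [V SV <-]; exact: H.
Qed.

Lemma ole_cover U S W :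
  ole U (osup S) -> (forall V, S V -> ole (omeet U V) W) -> ole U W.
Proof. by move=> US H; rewrite -(ole_omeetE US); exact: omeet_sup_le. Qed.

Definition bigmeet (I : Type) (v : I -> opens X) (l : seq I) : opens X :=
  foldr (fun i U => omeet (v i) U) otop l.

Lemma bigmeet_cons (I : Type) (v : I -> opens X) (i : I) (l : seq I) :
  bigmeet v (i :: l) = omeet (v i) (bigmeet v l).
Proof. by []. Qed.

Lemma bigmeet_cat (I : Type) (v : I -> opens X) (l l' : seq I) :
  bigmeet v (l ++ l') = omeet (bigmeet v l) (bigmeet v l').
Proof.
by elim: l => [|i l IH] /=; [rewrite omeetTl|rewrite IH omeetA].
Qed.

Lemma ole_bigmeet (I : eqType) (v : I -> opens X) (l : seq I) W :
  ole W (bigmeet v l) <-> (forall i, i \in l -> ole W (v i)).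
Proof.
elim: l => [|i l IH] /=; first by split=> // _; exact: ole_top.
split=> [/ole_meet[Wi /IH Wl] j|H].
- by rewrite inE => /orP[/eqP->//|/Wl].
- apply: ole_omeet; first by apply: H; rewrite mem_head.
  by apply/IH => j jl; apply: H; rewrite inE jl orbT.
Qed.

Lemma bigmeet_sub (I : eqType) (v : I -> opens X) (l l' : seq I) :
  {subset l <= l'} -> ole (bigmeet v l') (bigmeet v l).
Proof.
by move=> ll'; apply/ole_bigmeet => i /ll'; move: i; apply/ole_bigmeet/ole_refl.
Qed.

End LocaleTheory.

Section LocmapTheory.
Variables (X Y : locale) (f : locmap X Y).

Lemma inv_im_le U V : ole U V -> ole (f U) (f V).
Proof. by move=> /ole_omeetE <-; rewrite inv_im_meet; exact: omeet_ler. Qed.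

Lemma inv_im_bigmeet (I : Type) (v : I -> opens Y) (l : seq I) :
  f (bigmeet v l) = bigmeet (fun i => f (v i)) l.
Proof.
by elim: l => [|i l IH] /=; rewrite ?inv_im_top ?inv_im_meet ?IH.
Qed.

Lemma inv_im_bot : f (osup set0) = osup set0.
Proof. by rewrite inv_im_sup image_set0. Qed.

End LocmapTheory.

Definition discrete (A : Type) : locale.
Proof.
refine (@Locale (set A) (@subset A) setT setI
  (fun S => [set a | exists2 U, S U & U a]) _ _ _ _ _ _ _).
- exact: subset_refl.
- by move=> U V W UV VW a /UV/VW.
- by move=> U V UV VU; apply/seteqP.
- by [].
- move=> U V W; split; first by move=> H; split=> a /H[].
  by move=> [WU WV] a Wa; split; [exact: WU|exact: WV].
- move=> S W; split=> [H U SU a Ua|H a [U SU Ua]]; last exact: H SU _ Ua.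
  by apply: H; exists U.
- move=> U S; apply/seteqP; split=> a.
  + by move=> [Ua [V SV Va]]; exists (U `&` V) => //; exists V.
  + by move=> [_ [V SV <-] [Ua Va]]; split=> //; exists V.
Defined.

(* [sequent A B] is the axiom  /\A |- \/_{b in B} /\b ,  where finite lists of
   generators stand for their conjunctions. *)
Record theory := Theory {
  gen : eqType;
  sequent : seq gen -> set (seq gen) -> Prop
}.

Section Classifying.
Variable T : theory.
Implicit Types (l : seq (gen T)) (P U : set (seq (gen T))).

(* The finite conjunctions of generators form a meet-semilattice, where
   [l'] is below [l] when [l] is contained in [l']; the axioms induce a coverage
   on it, and the frame presented by T consists of the down-closed sets that
   are closed under this coverage. *)
Definition saturated U : Prop :=
  (forall l l', {subset l <= l'} -> U l -> U l') /\
  (forall A B l, sequent A B -> {subset A <= l} ->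
     (forall b, B b -> U (b ++ l)) -> U l).

Definition saturation P : set (seq (gen T)) :=
  [set l | forall U, saturated U -> P `<=` U -> U l].

Lemma saturation_saturated P : saturated (saturation P).
Proof.
split.
- by move=> l l' ll' Pl U sU PU; case: (sU) => + _; apply; [exact: ll'|exact: Pl].
- move=> A B l AB Al H U sU PU; case: (sU) => _; apply; [exact: AB|exact: Al|].
  by move=> b /H; apply.
Qed.

Lemma sub_saturation P : P `<=` saturation P.
Proof. by move=> l Pl U _; apply. Qed.

Lemma saturation_sub P U : saturated U -> P `<=` U -> saturation P `<=` U.
Proof. by move=> sU PU l; apply. Qed.

Lemma saturatedT : saturated setT.
Proof. by []. Qed.

Lemma saturatedI U V : saturated U -> saturated V -> saturated (U `&` V).
Proof.
move=> [U1 U2] [V1 V2]; split.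
- by move=> l l' ll' [Ul Vl]; split; [exact: U1 Ul|exact: V1 Vl].
- move=> A B l AB Al H; split.
  + by apply: (U2 A B) => // b /H[].
  + by apply: (V2 A B) => // b /H[].
Qed.

Lemma saturated_imp U W : saturated U -> saturated W ->
  saturated [set l : seq (gen T) | forall l', {subset l <= l'} -> U l' -> W l'].
Proof.
move=> [U1 U2] [W1 W2]; split.
- by move=> l l' ll' H m l'm; apply: H => x /ll'/l'm.
- move=> A B l AB Al H m lm Um; apply: (W2 A B) => //.
    by move=> x /Al/lm.
  move=> b Bb; apply: (H b Bb).
    by move=> x; rewrite !mem_cat => /orP[->//|/lm->]; rewrite orbT.
  by apply: U1 Um => x xm; rewrite mem_cat xm orbT.
Qed.

Definition copen := {U : set (seq (gen T)) | saturated U}.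

Lemma copen_inj (U V : copen) : sval U = sval V -> U = V.
Proof.
by case: U V => [U sU] [V sV] /= UV; subst V; congr exist; exact: Prop_irrelevance.
Qed.

Definition csat P : copen := exist _ _ (saturation_saturated P).

Definition classifying : locale.
Proof.
refine (@Locale copen (fun U V : copen => sval U `<=` sval V)
  (exist _ _ saturatedT)
  (fun U V : copen => exist _ _ (saturatedI (svalP U) (svalP V)))
  (fun S => csat [set l | exists2 U : copen, S U & sval U l]) _ _ _ _ _ _ _).
- by move=> U.
- by move=> U V W UV VW l /UV/VW.
- by move=> U V UV VU; apply/copen_inj/seteqP.
- by [].
- move=> U V W /=; split; first by move=> H; split=> a /H[].
  by move=> [WU WV] a Wa; split; [exact: WU|exact: WV].
- move=> S W /=; split.
  + by move=> H U SU l Ul; apply: H; apply: sub_saturation; exists U.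
  + move=> H; apply: saturation_sub; first exact: svalP.
    by move=> l [U SU Ul]; exact: H SU _ Ul.
- move=> U S; apply/copen_inj/seteqP; split=> l /=.
  + move=> [Ul Sl].
    set P := (X in saturation X l).
    have sH := saturated_imp (svalP U) (saturation_saturated P).
    apply: (saturation_sub sH _ Sl) => // m [V SV Vm] m' mm' Um'.
    apply: sub_saturation; exists (exist _ _ (saturatedI (svalP U) (svalP V))).
      by exists V.
    by split=> //=; case: (svalP V) => + _; apply; [exact: mm'|].
  + set P := [set l0 | exists2 U0, S U0 & _].
    move: l; apply: (saturation_sub (saturatedI (svalP U) (saturation_saturated P))).
    move=> m [_ [V SV <-] [Um Vm]]; split=> //.
    by apply: sub_saturation; exists V.
Defined.

Definition basic (g : gen T) : opens classifying :=
  csat [set [:: g]].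

Lemma saturated_catr U l : saturated U -> saturated [set m | U (m ++ l)].
Proof.
move=> [U1 U2]; split.
- move=> m m' mm'; apply: U1 => x; rewrite !mem_cat.
  by move=> /orP[/mm'->//|->]; rewrite orbT.
- move=> A B m AB Am H; apply: (U2 A B) => //.
    by move=> x /Am xm; rewrite mem_cat xm.
  by move=> b /H; rewrite /= catA.
Qed.

Lemma bigmeet_basic l : bigmeet basic l = csat [set l].
Proof.
have sat_up (m m' : seq (gen T)) : {subset m <= m'} -> saturation [set m] m'.
  move=> mm'; case: (saturation_saturated [set m]) => + _; apply; first exact: mm'.
  exact: sub_saturation.
apply: (@ole_anti classifying).
- elim: l => [|g l IH] /=; first by move=> m _; exact: sat_up.
  move=> m /= [gm /IH lm]; have [W1 _] := saturation_saturated [set g :: l].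
  have gl : saturation [set g :: l] (m ++ l).
    apply: (saturation_sub (saturated_catr l (saturation_saturated _)) _ gm) => _ ->.
    exact: sat_up.
  have : saturation [set g :: l] (m ++ m).
    apply: (saturation_sub (saturated_catr m (saturation_saturated _)) _ lm) => _ ->.
    by apply: W1 gl => x; rewrite !mem_cat orbC.
  by apply: W1 => x; rewrite mem_cat orbb.
- apply/ole_bigmeet => g gl; apply: saturation_sub (svalP (basic g)) _ => _ ->.
  by apply: sat_up => x; rewrite inE => /eqP->.
Qed.

Lemma copenE (U : opens classifying) :
  U = osup [set bigmeet basic l | l in sval U].
Proof.
apply: ole_anti.
- move=> l Ul; apply: sub_saturation; exists (bigmeet basic l); first by exists l.
  by rewrite bigmeet_basic; exact: sub_saturation.
- apply/osup_le => _ [l Ul <-]; rewrite bigmeet_basic.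
  by apply: saturation_sub (svalP U) _ => _ ->.
Qed.

Lemma locmap_classifying_rel (X : locale) (f g : locmap X classifying)
    (W : opens X) :
  (forall x, omeet W (f (basic x)) = omeet W (g (basic x))) ->
  forall U : opens classifying, omeet W (f U) = omeet W (g U).
Proof.
move=> fg U.
have fgl l : omeet W (f (bigmeet basic l)) = omeet W (g (bigmeet basic l)).
  elim: l => [|x l IH]; first by rewrite !inv_im_top.
  rewrite !bigmeet_cons !inv_im_meet !omeetA fg -!omeetA.
  rewrite (omeetC _ (f _)) (omeetC _ (g (bigmeet _ _))).
  by rewrite !omeetA IH.
rewrite (copenE U) !inv_im_sup !omeet_sup !image_comp.
by congr osup; apply/seteqP; split=> _ [l Ul <-]; exists l => //=.
Qed.

Lemma locmap_classifying_ext (X : locale) (f g : locmap X classifying) :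
  (forall x, f (basic x) = g (basic x)) -> f = g.
Proof.
move=> fg; apply: locmap_ext => U; rewrite -[f U]omeetTl -[g U]omeetTl.
by apply: locmap_classifying_rel => x; rewrite fg.
Qed.

Lemma basic_sequent A B : sequent A B ->
  ole (bigmeet basic A) (osup [set bigmeet basic b | b in B]).
Proof.
move=> AB; rewrite bigmeet_basic.
set W := osup _; have sW : saturated (sval W) := svalP W.
apply: (saturation_sub sW) => _ ->.
case: sW => _; apply; [exact: AB|by []|] => b Bb.
apply: sub_saturation; exists (bigmeet basic b); first by exists b.
rewrite bigmeet_basic; case: (saturation_saturated [set b]) => + _.
by apply; last exact: sub_saturation; move=> x xb; rewrite mem_cat xb.
Qed.

Definition is_model (X : locale) (v : gen T -> opens X) : Prop :=
  forall A B, sequent A B -> ole (bigmeet v A) (osup [set bigmeet v b | b in B]).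

Lemma saturated_model (X : locale) (v : gen T -> opens X) (hv : is_model v) W :
  saturated [set l | ole (bigmeet v l) W].
Proof.
split; first by move=> l l' ll'; apply: ole_trans; exact: bigmeet_sub.
move=> A B l AB Al H /=.
apply: (ole_cover (ole_trans (bigmeet_sub v Al) (hv A B AB))) => _ [b Bb <-].
by rewrite omeetC -bigmeet_cat; exact: H.
Qed.

(* The map X -> classifying T determined by a model of T in the frame of X,
   that is, by a generalised point of [classifying] at stage X. *)
Definition classify (X : locale) (v : gen T -> opens X) (hv : is_model v) :
  locmap X classifying.
Proof.
refine (@LocMap X classifying
  (fun U : opens classifying => osup [set bigmeet v l | l in sval U]) _ _ _).
- by apply: ole_anti; [exact: ole_top|apply: ole_sup; exists [::]].
- move=> U V; apply: ole_anti.
    apply/osup_le => _ [l [Ul Vl] <-].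
    by apply: ole_omeet; apply: ole_sup; exists l.
  apply: omeet_sup_le => _ [l Vl <-]; rewrite omeetC.
  apply: omeet_sup_le => _ [m Um <-]; rewrite -bigmeet_cat.
  apply: ole_sup; exists (l ++ m) => //; split.
  + by case: (svalP U) => + _; apply; [|exact: Um] => x; rewrite mem_cat orbC => ->.
  + by case: (svalP V) => + _; apply; [|exact: Vl] => x; rewrite mem_cat => ->.
- move=> S; apply: ole_anti; last first.
    apply/osup_le => _ [U SU <-]; apply/osup_le => _ [l Ul <-].
    by apply: ole_sup; exists l => //; apply: sub_saturation; exists U.
  apply/osup_le => _ [l Sl <-].
  apply: (saturation_sub (saturated_model hv (osup _)) _ Sl) => {Sl}l.
  move=> [U SU Ul]; apply: ole_trans (ole_sup _); last by exists U.
  by apply: ole_sup; exists l.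
Defined.

Lemma classify_basic (X : locale) (v : gen T -> opens X) (hv : is_model v) x :
  classify hv (basic x) = v x.
Proof.
apply: ole_anti; last first.
  apply: ole_trans (ole_sup _); last first.
    by exists [:: x] => //; exact: sub_saturation.
  by rewrite /= omeetT; exact: ole_refl.
apply/osup_le => _ [l xl <-].
apply: (saturation_sub (saturated_model hv (v x)) _ xl) => _ ->.
exact: omeet_lel.
Qed.

End Classifying.

Definition sign := bool.

Definition sgn (b : sign) : rat := if b then 1 else -1.

(* The generator [(n, b)] says that the (n+1)-st term of the stream is [b]. *)
Inductive stream_sequent : seq (nat * sign) -> set (seq (nat * sign)) -> Prop :=
| stream_total n : stream_sequent [::] [set [:: (n, b)] | b in setT]
| stream_single n b b' : b != b' -> stream_sequent [:: (n, b); (n, b')] set0.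

Definition cantor : locale := classifying (Theory stream_sequent).

Definition term (n : nat) (b : sign) : opens cantor :=
  @basic (Theory stream_sequent) (n, b).

Definition scat (s : seq sign) (t : nat -> sign) : nat -> sign :=
  fun n => nth (t (n - size s)%N) s n.

(* [zero false] is 0_- = +-^omega and [zero true] is 0_+ = -+^omega. *)
Definition zero (b : sign) : nat -> sign := scat [:: ~~ b] (fun=> b).

Lemma streams_model (A : Type) (f : A -> nat -> sign) :
  @is_model (Theory stream_sequent) (discrete A) (fun g => [set a | f a g.1 = g.2]).
Proof.
move=> _ _ [n|n b b' /eqP bb'] a /=.
- move=> _; exists ([set x | f x n = f a n] `&` setT) => //.
  by exists [:: (n, f a n)] => //; exists (f a n).
- by move=> [fb [fb' _]]; case: bb'; rewrite -fb.
Qed.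

Definition streams (A : Type) (f : A -> nat -> sign) :
  locmap (discrete A) cantor := classify (@streams_model A f).

Definition u (b : sign) : locmap (discrete (seq sign)) cantor :=
  streams (fun s => scat s (zero b)).

Notation u_minus := (u false).
Notation u_plus := (u true).

(* The generators [lower q] and [upper q] say q < x and x < q; the sequents say
   that x is a Dedekind section with -1 <= x <= 1. *)
Definition lower (q : rat) : rat + rat := inl q.
Definition upper (q : rat) : rat + rat := inr q.

Inductive interval_sequent : seq (rat + rat) -> set (seq (rat + rat)) -> Prop :=
| lower_inhabited : interval_sequent [::] [set [:: lower q] | q in setT]
| upper_inhabited : interval_sequent [::] [set [:: upper q] | q in setT]
| lower_rounded q :
    interval_sequent [:: lower q] [set [:: lower r] | r in [set r | q < r]]
| upper_rounded q :
    interval_sequent [:: upper q] [set [:: upper r] | r in [set r | r < q]]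
| lower_closed q r : q < r ->
    interval_sequent [:: lower r] [set [:: lower q]]
| upper_closed q r : q < r ->
    interval_sequent [:: upper q] [set [:: upper r]]
| cut_disjoint q : interval_sequent [:: lower q; upper q] set0
| cut_located q r : q < r ->
    interval_sequent [::] [set [:: lower q]; [:: upper r]]
| ge_m1 : interval_sequent [:: upper (-1)] set0
| le_1 : interval_sequent [:: lower 1] set0.

Definition interval : locale := classifying (Theory interval_sequent).

Definition open_gt (q : rat) : opens interval :=
  @basic (Theory interval_sequent) (lower q).
Definition open_lt (q : rat) : opens interval :=
  @basic (Theory interval_sequent) (upper q).

Definition psum (s : seq sign) : rat :=
  \sum_(i < size s) sgn (nth false s i) / 2 ^+ i.+1.

(* c maps the cylinder of streams with prefix s onto [lo s, hi s]. *)
Definition lo (s : seq sign) : rat := psum s - 1 / 2 ^+ size s.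
Definition hi (s : seq sign) : rat := psum s + 1 / 2 ^+ size s.

Definition cyl (s : seq sign) : opens cantor :=
  bigmeet (@basic (Theory stream_sequent)) (zip (iota 0 (size s)) s).

Definition c_cut (g : rat + rat) : opens cantor :=
  match g with
  | inl q => osup [set cyl s | s in [set s | q < lo s]]
  | inr q => osup [set cyl s | s in [set s | hi s < q]]
  end.

Lemma psum_cons b s : psum (b :: s) = (sgn b + psum s) / 2.
Proof.
rewrite /psum /= big_ord_recl /= mulrDl big_distrl /=; congr (_ + _).
by apply: eq_bigr => i _; rewrite /bump /= add1n -mulrA -invfM -exprSr.
Qed.

Lemma lo_cons b s : lo (b :: s) = (sgn b + lo s) / 2.
Proof. by rewrite /lo psum_cons /= exprS invfM; lra. Qed.

Lemma hi_cons b s : hi (b :: s) = (sgn b + hi s) / 2.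
Proof. by rewrite /hi psum_cons /= exprS invfM; lra. Qed.

Lemma lo_lt_hi s : lo s < hi s.
Proof.
have : 0 < 1 / 2 ^+ size s :> rat by rewrite divr_gt0 // exprn_gt0.
by rewrite /lo /hi; lra.
Qed.

Lemma lo_nil : lo [::] = -1.
Proof. by rewrite /lo /psum big_ord0 /= expr0; lra. Qed.

Lemma hi_nil : hi [::] = 1.
Proof. by rewrite /hi /psum big_ord0 /= expr0; lra. Qed.

Lemma lo_ge s : -1 <= lo s.
Proof.
by elim: s => [|[] s]; rewrite ?lo_nil ?lo_cons /sgn //; lra.
Qed.

Lemma hi_le s : hi s <= 1.
Proof.
by elim: s => [|[] s]; rewrite ?hi_nil ?hi_cons /sgn //; lra.
Qed.

Lemma term_disjoint n b b' U : b != b' -> ole (omeet (term n b) (term n b')) U.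
Proof.
move=> bb'; have := basic_sequent (T := Theory stream_sequent) (stream_single n bb').
rewrite /= image_set0 omeetT => /ole_trans; apply; exact: osup0_le.
Qed.

Lemma term_total n (U : opens cantor) W :
  (forall b, ole (omeet U (term n b)) W) -> ole U W.
Proof.
move=> H; have := basic_sequent (T := Theory stream_sequent) (stream_total n).
move=> /(ole_trans (ole_top U)) /ole_cover; apply => _ [_ [b _ <-] <-].
by rewrite /= omeetT; exact: H.
Qed.

Lemma cons_model (b : sign) : @is_model (Theory stream_sequent) cantor
  (fun g => match g with
            | (0%N, b') => if b == b' then otop else osup set0
            | (n.+1, b') => term n b'
            end).
Proof.
move=> _ _ [[|n]|[|n] b1 b2 b12] /=.
- apply: ole_trans (ole_sup _); last by exists [:: (0%N, b)] => //; exists b.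
  by rewrite /= eqxx omeetT; exact: ole_refl.
- apply: (term_total (n := n)) => b'; rewrite omeetTl.
  apply: ole_trans (ole_sup _); last by exists [:: (n.+1, b')] => //; exists b'.
  by rewrite /= omeetT; exact: ole_refl.
- rewrite omeetT; case: eqP => [bb1|_]; last first.
    exact: ole_trans (omeet_lel _ _) (osup0_le _).
  case: eqP => [bb2|_]; first by rewrite -bb1 -bb2 eqxx in b12.
  exact: ole_trans (omeet_ler _ _) (osup0_le _).
- by rewrite omeetT; exact: term_disjoint.
Qed.

(* Prefixing a sign to a stream. *)
Definition cons_map (b : sign) : locmap cantor cantor :=
  classify (@cons_model b).

Lemma tail_model : @is_model (Theory stream_sequent) cantor
  (fun g => term g.1.+1 g.2).
Proof.
move=> _ _ [n|n b1 b2 b12] /=.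
- apply: (term_total (n := n.+1)) => b; rewrite omeetTl.
  apply: ole_trans (ole_sup _); last by exists [:: (n, b)] => //; exists b.
  by rewrite /= omeetT; exact: ole_refl.
- by rewrite omeetT; exact: term_disjoint.
Qed.

Definition tail_map : locmap cantor cantor := classify (@tail_model).

Lemma cons_map0 b b' :
  cons_map b (term 0 b') = if b == b' then otop else osup set0.
Proof. exact: classify_basic. Qed.

Lemma cons_mapS b n b' : cons_map b (term n.+1 b') = term n b'.
Proof. exact: classify_basic. Qed.

Lemma tail_mapE n b' : tail_map (term n b') = term n.+1 b'.
Proof. exact: classify_basic. Qed.

Lemma cyl_nil : cyl [::] = otop.
Proof. by []. Qed.

Lemma cyl_cons b s : cyl (b :: s) = omeet (term 0 b) (tail_map (cyl s)).
Proof.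
rewrite /cyl [zip _ _]/= bigmeet_cons inv_im_bigmeet; congr omeet.
elim: s 0%N => [|b' s IH] n //.
rewrite [zip _ _]/= [zip (iota n _) _]/= !bigmeet_cons IH.
by rewrite -/(term n b') tail_mapE.
Qed.

Lemma cons_tail b U :
  omeet (term 0 b) (tail_map (cons_map b U)) = omeet (term 0 b) U.
Proof.
apply: (@locmap_classifying_rel (Theory stream_sequent) _
  (cons_map b \oL tail_map) (locid cantor)) => -[[|n] b'].
- rewrite loccompE locidE -/(term 0 b') cons_map0; case: eqP => [->|/eqP bb'].
    by rewrite inv_im_top omeetT omeetUU.
  rewrite inv_im_bot; apply: ole_anti; last exact: term_disjoint.
  exact: ole_trans (omeet_ler _ _) (osup0_le _).
- by rewrite loccompE -/(term n.+1 b') cons_mapS tail_mapE.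
Qed.

Lemma cyl_total n (U W : opens cantor) :
  (forall s, size s = n -> ole (omeet U (cyl s)) W) -> ole U W.
Proof.
move=> H; suff : ole otop (osup [set cyl s | s in [set s | size s = n]]).
  by move=> /(ole_trans (ole_top U))/ole_cover; apply => _ [s sn <-]; exact: H.
elim: n {U W H} => [|n IH]; first by apply: ole_sup; exists [::].
apply: (term_total (n := 0%N)) => b; rewrite omeetTl.
have := inv_im_le tail_map IH; rewrite inv_im_top inv_im_sup image_comp.
move=> /(ole_trans (ole_top (term 0 b)))/ole_cover; apply => _ [s sn <-].
by rewrite -cyl_cons; apply: ole_sup; exists (b :: s) => //=; rewrite sn.
Qed.

Lemma cyl_disjoint s t U : hi t <= lo s -> ole (omeet (cyl s) (cyl t)) U.
Proof.
move=> ts; apply: ole_trans (osup0_le U).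
elim: s t ts => [|b s IH] [|b' t].
- by rewrite lo_nil hi_nil; lra.
- by rewrite lo_nil; have := lo_ge (b' :: t); have := lo_lt_hi (b' :: t); lra.
- by rewrite hi_nil; have := hi_le (b :: s); have := lo_lt_hi (b :: s); lra.
rewrite !cyl_cons lo_cons hi_cons; case: (eqVneq b b') => [<-|bb'] ts; last first.
  apply: (ole_trans _ (@term_disjoint 0 b b' _ bb')).
  exact: omeet_mono (omeet_lel _ _) (omeet_lel _ _).
apply: ole_trans (omeet_mono (omeet_ler _ _) (omeet_ler _ _)) _.
rewrite -inv_im_meet -[X in ole _ X](inv_im_bot tail_map).
by apply: inv_im_le; apply: IH; lra.
Qed.

Lemma small_cyl (e : rat) : 0 < e ->
  exists n, forall s, size s = n -> hi s - lo s < e.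
Proof.
move=> e0; have [n ne] : exists n, 2 / e < n%:R.
  by exists (Num.bound (2 / e)); apply: archi_boundP; rewrite divr_ge0 // ltW.
exists n => s sn.
have n2 : n%:R < 2 ^+ n :> rat by rewrite -natrX ltr_nat ltn_expl.
have := lt_trans ne n2; rewrite ltr_pdivrMr // => en.
suff -> : hi s - lo s = 2 / 2 ^+ n by rewrite ltr_pdivrMr ?exprn_gt0 // mulrC.
by rewrite /hi /lo sn; move: (psum s) ((2 ^+ n)^-1) => p x; lra.
Qed.

Record is_cut (X : locale) (L R : rat -> opens X) : Prop := IsCut {
  cutL_inh : ole otop (osup [set L q | q in setT]);
  cutR_inh : ole otop (osup [set R q | q in setT]);
  cutL_round : forall q, ole (L q) (osup [set L r | r in [set r | q < r]]);
  cutR_round : forall q, ole (R q) (osup [set R r | r in [set r | r < q]]);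
  cutL_mono : forall q r, q < r -> ole (L r) (L q);
  cutR_mono : forall q r, q < r -> ole (R q) (R r);
  cut_disj : forall q, ole (omeet (L q) (R q)) (osup set0);
  cut_loc : forall q r, q < r -> ole otop (osup [set L q; R r]);
  cut_ge : ole (R (-1)) (osup set0);
  cut_le : ole (L 1) (osup set0)
}.

Lemma cut_modelP (X : locale) (v : rat + rat -> opens X) :
  @is_model (Theory interval_sequent) X v <->
  is_cut (fun q => v (lower q)) (fun q => v (upper q)).
Proof.
have imE (h : rat -> rat + rat) (D : set rat) :
    [set bigmeet v b | b in [set [:: h q] | q in D]] = [set v (h q) | q in D].
  rewrite image_comp; congr image; apply/funext => q /=.
  by rewrite omeetT.
have im1 g : [set bigmeet v b | b in [set [:: g]]] = [set v g].
  by rewrite image_set1 /= omeetT.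
have im2 g g' : [set bigmeet v b | b in [set [:: g]; [:: g']]] = [set v g; v g'].
  by rewrite image_setU !image_set1 /= !omeetT.
have sup1 U : @osup X [set U] = U.
  apply: ole_anti; last exact: ole_sup.
  by apply/osup_le => _ ->; exact: ole_refl.
split=> [m|m].
- split.
  + by have := m _ _ lower_inhabited; rewrite imE.
  + by have := m _ _ upper_inhabited; rewrite imE.
  + by move=> q; have := m _ _ (lower_rounded q); rewrite imE /= omeetT.
  + by move=> q; have := m _ _ (upper_rounded q); rewrite imE /= omeetT.
  + by move=> q r qr; have := m _ _ (lower_closed qr); rewrite im1 sup1 /= omeetT.
  + by move=> q r qr; have := m _ _ (upper_closed qr); rewrite im1 sup1 /= omeetT.
  + by move=> q; have := m _ _ (cut_disjoint q); rewrite image_set0 /= omeetT.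
  + by move=> q r qr; have := m _ _ (cut_located qr); rewrite im2.
  + by have := m _ _ ge_m1; rewrite image_set0 /= omeetT.
  + by have := m _ _ le_1; rewrite image_set0 /= omeetT.
- move=> _ _ []; rewrite ?imE ?im2 ?image_set0.
  + exact: cutL_inh m.
  + exact: cutR_inh m.
  + by move=> q; rewrite imE /= omeetT; exact: (cutL_round m).
  + by move=> q; rewrite imE /= omeetT; exact: (cutR_round m).
  + by move=> q r qr; rewrite im1 sup1 /= omeetT; exact: (cutL_mono m).
  + by move=> q r qr; rewrite im1 sup1 /= omeetT; exact: (cutR_mono m).
  + by move=> q; rewrite /= omeetT; exact: (cut_disj m).
  + by move=> q r qr; rewrite im2; exact: (cut_loc m).
  + by rewrite /= omeetT; exact: (cut_ge m).
  + by rewrite /= omeetT; exact: (cut_le m).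
Qed.

Lemma c_model : @is_model (Theory interval_sequent) cantor c_cut.
Proof.
apply/cut_modelP; split=> /=.
- apply: ole_trans (ole_sup _); last by exists (-2).
  apply: ole_sup; exists [::]; last exact: cyl_nil.
  by rewrite /mkset lo_nil; lra.
- apply: ole_trans (ole_sup _); last by exists 2.
  apply: ole_sup; exists [::]; last exact: cyl_nil.
  by rewrite /mkset hi_nil; lra.
- move=> q; apply/osup_le => _ [s /= qs <-].
  apply: ole_trans (ole_sup _); last by exists ((q + lo s) / 2) => //=; lra.
  by apply: ole_sup; exists s => //=; lra.
- move=> q; apply/osup_le => _ [s /= qs <-].
  apply: ole_trans (ole_sup _); last by exists ((q + hi s) / 2) => //=; lra.
  by apply: ole_sup; exists s => //=; lra.
- move=> q r qr; apply/osup_le => _ [s /= rs <-].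
  by apply: ole_sup; exists s => //=; lra.
- move=> q r qr; apply/osup_le => _ [s /= rs <-].
  by apply: ole_sup; exists s => //=; lra.
- move=> q; apply: omeet_sup_le => _ [t /= tq <-]; rewrite omeetC.
  apply: omeet_sup_le => _ [s /= qs <-]; rewrite omeetC.
  by apply: cyl_disjoint; lra.
- move=> q r qr.
  have [n Hn] : exists n, forall s, size s = n -> hi s - lo s < r - q.
    by apply: small_cyl; lra.
  apply: (cyl_total (n := n)) => s /Hn sn; rewrite omeetTl.
  case: (ltP q (lo s)) => qs.
  + apply: ole_trans (ole_sup _); last by left; reflexivity.
    by apply: ole_sup; exists s.
  + apply: ole_trans (ole_sup _); last by right; reflexivity.
    by apply: ole_sup; exists s => //=; lra.
- apply/osup_le => _ [s /= sm <-].
  by have := lo_ge s; have := lo_lt_hi s; lra.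
- apply/osup_le => _ [s /= sm <-].
  by have := hi_le s; have := lo_lt_hi s; lra.
Qed.

Definition c : locmap cantor interval := classify (@c_model).

Lemma interval_cut (X : locale) (d : locmap X interval) :
  is_cut (fun q => d (open_gt q)) (fun q => d (open_lt q)).
Proof.
pose v g := d (@basic (Theory interval_sequent) g).
apply: (iffLR (cut_modelP v)) => A B AB; rewrite -inv_im_bigmeet.
apply: ole_trans (inv_im_le d (basic_sequent AB)) _.
rewrite inv_im_sup image_comp; apply/osup_le => _ [b Bb <-] /=.
by rewrite inv_im_bigmeet; apply: ole_sup; exists b.
Qed.

(* The cut of (b + x) / 2. *)
Definition avg_cut (b : sign) (g : rat + rat) : opens interval :=
  match g with
  | inl q => open_gt (2 * q - sgn b)
  | inr q => open_lt (2 * q - sgn b)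
  end.

Lemma avg_model b : @is_model (Theory interval_sequent) interval (avg_cut b).
Proof.
have := interval_cut (locid interval) => /= -[L0 R0 L1 R1 L2 R2 D C G1 G2].
have dbl q : q = 2 * ((q + sgn b) / 2) - sgn b by lra.
apply/cut_modelP; split=> /=.
- apply: ole_trans L0 _; apply/osup_le => _ [q _ <-].
  by rewrite [q]dbl; apply: ole_sup; eexists.
- apply: ole_trans R0 _; apply/osup_le => _ [q _ <-].
  by rewrite [q]dbl; apply: ole_sup; eexists.
- move=> q; apply: ole_trans (L1 _) _; apply/osup_le => _ [r /= qr <-].
  by rewrite [r]dbl; apply: ole_sup; eexists => //=; lra.
- move=> q; apply: ole_trans (R1 _) _; apply/osup_le => _ [r /= qr <-].
  by rewrite [r]dbl; apply: ole_sup; eexists => //=; lra.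
- by move=> q r qr; apply: L2; lra.
- by move=> q r qr; apply: R2; lra.
- by move=> q; exact: D.
- by move=> q r qr; apply: C; lra.
- case: b {dbl}; rewrite /sgn; last by have -> : 2 * -1 - -1 = -1 :> rat by lra.
  by apply: ole_trans (R2 _ (-1) _) G1; lra.
- case: b {dbl}; rewrite /sgn; first by have -> : 2 * 1 - 1 = 1 :> rat by lra.
  by apply: ole_trans (L2 1 _ _) G2; lra.
Qed.

Definition avg_map (b : sign) : locmap interval interval :=
  classify (@avg_model b).

Lemma avg_gt b q : avg_map b (open_gt q) = open_gt (2 * q - sgn b).
Proof. exact: classify_basic. Qed.

Lemma avg_lt b q : avg_map b (open_lt q) = open_lt (2 * q - sgn b).
Proof. exact: classify_basic. Qed.

Lemma c_gt q : c (open_gt q) = osup [set cyl s | s in [set s | q < lo s]].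
Proof. exact: classify_basic. Qed.

Lemma c_lt q : c (open_lt q) = osup [set cyl s | s in [set s | hi s < q]].
Proof. exact: classify_basic. Qed.

Lemma cons_tailK b U : cons_map b (tail_map U) = U.
Proof.
have E : tail_map \oL cons_map b = locid cantor.
  apply: locmap_classifying_ext => -[n b'].
  by rewrite loccompE -/(term n b') tail_mapE cons_mapS.
exact: (congr1 (fun f : locmap _ _ => f U) E).
Qed.

Lemma cons_cyl b b' s :
  cons_map b (cyl (b' :: s)) = if b == b' then cyl s else osup set0.
Proof.
rewrite cyl_cons inv_im_meet cons_map0 cons_tailK.
case: ifP => _; first by rewrite omeetTl.
by apply: ole_anti; [exact: omeet_lel|exact: osup0_le].
Qed.

(* c is the unique map with c (b s) = (b + c s) / 2. *)
Lemma c_cons b : c \oL cons_map b = avg_map b \oL c.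
Proof.
apply: locmap_classifying_ext => -[q|q]; rewrite !loccompE.
- rewrite -/(open_gt q) avg_gt !c_gt inv_im_sup; apply: ole_anti.
  + apply/osup_le => _ [_ [[|b' s] qs <-] <-].
      rewrite cyl_nil inv_im_top; apply: ole_sup; exists [::] => //.
      by move: qs; rewrite /mkset lo_nil /sgn; case: b; lra.
    rewrite cons_cyl; case: eqP => [bb'|_]; last exact: osup0_le.
    by apply: ole_sup; exists s => //; move: qs; rewrite /mkset lo_cons bb'; lra.
  + apply/osup_le => _ [s qs <-]; apply: ole_sup; exists (cyl (b :: s)).
      by exists (b :: s) => //; move: qs; rewrite /mkset lo_cons; lra.
    by rewrite cons_cyl eqxx.
- rewrite -/(open_lt q) avg_lt !c_lt inv_im_sup; apply: ole_anti.
  + apply/osup_le => _ [_ [[|b' s] qs <-] <-].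
      rewrite cyl_nil inv_im_top; apply: ole_sup; exists [::] => //.
      by move: qs; rewrite /mkset hi_nil /sgn; case: b; lra.
    rewrite cons_cyl; case: eqP => [bb'|_]; last exact: osup0_le.
    by apply: ole_sup; exists s => //; move: qs; rewrite /mkset hi_cons bb'; lra.
  + apply/osup_le => _ [s qs <-]; apply: ole_sup; exists (cyl (b :: s)).
      by exists (b :: s) => //; move: qs; rewrite /mkset hi_cons; lra.
    by rewrite cons_cyl eqxx.
Qed.

Section Uniqueness.
Variable d : locmap cantor interval.
Hypothesis d_cons : forall b, d \oL cons_map b = avg_map b \oL d.

Let d_consE b U : cons_map b (d U) = d (avg_map b U).
Proof. exact: (congr1 (fun f : locmap _ _ => f U) (d_cons b)). Qed.

Let cyl_le_lt s r : hi s < r -> ole (cyl s) (d (open_lt r)).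
Proof.
elim: s r => [|b s IH] r.
  rewrite hi_nil cyl_nil => r1; have [_ _ _ _ _ _ _ C _ G] := interval_cut d.
  apply: ole_cover (C _ _ r1) _ => _ [->|->]; last exact: omeet_ler.
  exact: ole_trans (omeet_ler _ _) (ole_trans G (osup0_le _)).
rewrite hi_cons => sr; have {}sr : hi s < 2 * r - sgn b by lra.
have := IH _ sr; rewrite -avg_lt -d_consE => /(inv_im_le tail_map) H.
rewrite cyl_cons; apply: ole_trans (omeet_mono (ole_refl _) H) _.
by rewrite cons_tail; exact: omeet_ler.
Qed.

Let cyl_le_gt s r : r < lo s -> ole (cyl s) (d (open_gt r)).
Proof.
elim: s r => [|b s IH] r.
  rewrite lo_nil cyl_nil => r1; have [_ _ _ _ _ _ _ C G _] := interval_cut d.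
  apply: ole_cover (C _ _ r1) _ => _ [->|->]; first exact: omeet_ler.
  exact: ole_trans (omeet_ler _ _) (ole_trans G (osup0_le _)).
rewrite lo_cons => sr; have {}sr : 2 * r - sgn b < lo s by lra.
have := IH _ sr; rewrite -avg_gt -d_consE => /(inv_im_le tail_map) H.
rewrite cyl_cons; apply: ole_trans (omeet_mono (ole_refl _) H) _.
by rewrite cons_tail; exact: omeet_ler.
Qed.

Lemma c_unique : d = c.
Proof.
have [_ _ L1 R1 _ _ D _ _ _] := interval_cut d.
apply: locmap_classifying_ext => -[q|q].
- rewrite -/(open_gt q) c_gt; apply: ole_anti; last first.
    by apply/osup_le => _ [s /= qs <-]; exact: cyl_le_gt.
  apply: ole_trans (L1 q) _; apply/osup_le => _ [r /= qr <-].
  have [n Hn] : exists n, forall s, size s = n -> hi s - lo s < r - q.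
    by apply: small_cyl; lra.
  apply: (cyl_total (n := n)) => s /Hn sn.
  case: (ltP q (lo s)) => qs.
    by apply: ole_trans (omeet_ler _ _) _; apply: ole_sup; exists s.
  apply: ole_trans (omeet_mono (ole_refl _) (cyl_le_lt (r := r) _)) _.
    by lra.
  exact: ole_trans (D r) (osup0_le _).
- rewrite -/(open_lt q) c_lt; apply: ole_anti; last first.
    by apply/osup_le => _ [s /= qs <-]; exact: cyl_le_lt.
  apply: ole_trans (R1 q) _; apply/osup_le => _ [r /= qr <-].
  have [n Hn] : exists n, forall s, size s = n -> hi s - lo s < q - r.
    by apply: small_cyl; lra.
  apply: (cyl_total (n := n)) => s /Hn sn.
  case: (ltP (hi s) q) => qs.
    by apply: ole_trans (omeet_ler _ _) _; apply: ole_sup; exists s.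
  apply: ole_trans (omeet_mono (ole_refl _) (cyl_le_gt (r := r) _)) _.
    by lra.
  by rewrite omeetC; exact: ole_trans (D r) (osup0_le _).
Qed.

End Uniqueness.

(* Main.v *)
(** A coequalizer of locales is an equalizer of frames, so the claim is that the
    inverse image map of [c] is injective and that its image consists of the
    opens [U] that contain [s 0_+] if and only if they contain [s 0_-], for all
    [s].  Both parts rest on bar induction over finite sign sequences, that is,
    on the compactness of Cantor space.  Injectivity: bar induction shows that
    only the top open of the interval is pulled back to the top, and regularity
    of the interval extends this to all opens.  Image: two distinct streams have
    the same value under [c] only if they are [s 0_+] and [s 0_-] for some [s];
    hence such a [U] is a union of fibres of [c], and bar induction provides,
    for every stream [x] in [U], a rational interval around [c x] whose inverse
    image lies in [U]. *)

From mathcomp Require Import all_boot all_order all_algebra.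
From mathcomp Require Import boolp classical_sets.
From mathcomp Require Import lra.
Require Import Defs.

Set Implicit Arguments.
Unset Strict Implicit.
Unset Printing Implicit Defensive.

Import Order.TTheory GRing.Theory Num.Theory.

Local Open Scope classical_set_scope.
Local Open Scope ring_scope.

(** * Equalizers of frames, and bar induction *)

(** Choosing a preimage under [e] of each [h W] defines the factorisation; injectivity of [e] makes
    it a frame homomorphism and unique. *)
Lemma coequalizer_of_frame_equalizer (A X Y : locale) (f g : locmap A X)
    (e : locmap X Y) :
  e \oL f = e \oL g -> injective e ->
  (forall U, f U = g U -> exists V, e V = U) -> is_coequalizer f g e.
Proof.
move=> efg einj eim; split=> // Z h hfg.
have hE W : f (h W) = g (h W).
  exact: (congr1 (fun k : locmap _ _ => k W) hfg).
have [k kE] := choice (fun W => eim _ (hE W)).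
have k1 : k otop = otop by apply: einj; rewrite kE !inv_im_top.
have k2 U V : k (omeet U V) = omeet (k U) (k V).
  by apply: einj; rewrite kE !inv_im_meet !kE.
have k3 S : k (osup S) = osup [set k V | V in S].
  apply: einj; rewrite kE !inv_im_sup image_comp.
  by congr osup; apply: eq_imagel => V _ /=; rewrite kE.
exists (LocMap k1 k2 k3); split; first exact: locmap_ext.
move=> k' k'E; apply: locmap_ext => U /=; apply: einj.
by rewrite kE -k'E.
Qed.

(** By contraposition: where [P] fails it also fails at some child, and choosing such children from
    the root on gives a stream with no prefix in [P]. *)
Lemma bar_induction (P : seq bool -> Prop) :
  (forall s, (forall b, P (rcons s b)) -> P s) ->
  (forall x : nat -> bool, exists n, P (mkseq x n)) -> P [::].
Proof.
move=> Pind Pbar; apply: contrapT => nP.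
have /choice[b bP] s : exists b, ~ P s -> ~ P (rcons s b).
  have [Ps|nPs] := pselect (P s); first by exists true.
  apply: contrapT => nb; apply/nPs/Pind => b; apply: contrapT => nPb.
  by apply: nb; exists b.
pose t n := iter n (fun s => rcons s (b s)) [::].
have [n] := Pbar (fun n => b (t n)).
have -> : mkseq (fun n => b (t n)) n = t n.
  by elim: n => [|n IH]; rewrite ?mkseqS ?IH.
by elim: n => [//|n IH]; apply: bP.
Qed.

(** * Endpoints of cylinders along a stream *)

Lemma mkseq_cons (T : Type) (x : nat -> T) n :
  mkseq x n.+1 = x 0%N :: mkseq (x \o S) n.
Proof. by rewrite /mkseq /= (iotaDl 1 0) -map_comp. Qed.

Lemma lo_rcons s b : lo (rcons s b) = if b then (lo s + hi s) / 2 else lo s.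
Proof.
elim: s => [|a s IH].
  by rewrite lo_cons lo_nil hi_nil; case: b; rewrite /sgn; lra.
by rewrite rcons_cons !lo_cons hi_cons IH; case: b {IH}; lra.
Qed.

Lemma hi_rcons s b : hi (rcons s b) = if b then hi s else (lo s + hi s) / 2.
Proof.
elim: s => [|a s IH].
  by rewrite hi_cons lo_nil hi_nil; case: b; rewrite /sgn; lra.
by rewrite rcons_cons !hi_cons lo_cons IH; case: b {IH}; lra.
Qed.

Lemma lo_mkseq (x : nat -> sign) m n : (m <= n)%N ->
  lo (mkseq x m) <= lo (mkseq x n).
Proof.
move=> /subnK <-; elim: (n - m)%N => [//|k IH]; rewrite addSn mkseqS lo_rcons.
by have := lo_lt_hi (mkseq x (k + m)); case: (x _); lra.
Qed.

Lemma hi_mkseq (x : nat -> sign) m n : (m <= n)%N ->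
  hi (mkseq x n) <= hi (mkseq x m).
Proof.
move=> /subnK <-; elim: (n - m)%N => [//|k IH]; rewrite addSn mkseqS hi_rcons.
by have := lo_lt_hi (mkseq x (k + m)); case: (x _); lra.
Qed.

(** * Streams with the same value *)

Lemma hi_eq1 s : hi s = 1 <-> s = nseq (size s) true.
Proof.
elim: s => [|b s IH]; first by rewrite hi_nil.
rewrite hi_cons /=; have := hi_le s.
case: b; rewrite /sgn => s1; split.
- by move=> bs; congr cons; apply/IH; lra.
- by move=> [/IH]; lra.
- by move=> ?; exfalso; clear IH; lra.
- by [].
Qed.

Lemma lo_eqN1 s : lo s = -1 <-> s = nseq (size s) false.
Proof.
elim: s => [|b s IH]; first by rewrite lo_nil.
rewrite lo_cons /=; have := lo_ge s.
case: b; rewrite /sgn => s1; split.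
- by move=> ?; exfalso; clear IH; lra.
- by [].
- by move=> bs; congr cons; apply/IH; lra.
- by move=> [/IH]; lra.
Qed.

(* [meets x y] says that c x = c y. *)
Definition meets (x y : nat -> sign) : Prop := forall n,
  lo (mkseq x n) <= hi (mkseq y n) /\ lo (mkseq y n) <= hi (mkseq x n).

Lemma meets_sym x y : meets x y -> meets y x.
Proof. by move=> xy n; case: (xy n). Qed.

Lemma meets_tail x y : x 0%N = y 0%N -> meets x y <-> meets (x \o S) (y \o S).
Proof.
move=> xy0; split=> xy [|n].
- by rewrite lo_nil hi_nil; lra.
- have := xy n.+2; rewrite !(mkseq_cons x) !(mkseq_cons y) xy0 !lo_cons !hi_cons.
  by lra.
- by rewrite lo_nil hi_nil; lra.
- by have := xy n; rewrite !mkseq_cons xy0 !lo_cons !hi_cons; lra.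
Qed.

Lemma mkseq_const (T : Type) (b : T) (x : nat -> T) n :
  (forall i, x i = b) -> mkseq x n = nseq n b.
Proof.
by elim: n x => [//|n IH] x xb; rewrite mkseq_cons xb IH // => i; exact: xb.
Qed.

Lemma meets_zero s : meets (scat s (zero true)) (scat s (zero false)).
Proof.
elim: s => [|b s IH]; last by apply/meets_tail.
have zS b n : (scat [::] (zero b) \o S) n = b.
  by rewrite /scat /= /zero /scat /= nth_nil.
move=> [|n]; first by rewrite lo_nil hi_nil; lra.
rewrite !mkseq_cons !(mkseq_const _ (zS _)) !lo_cons !hi_cons.
(* The cylinders around [0_+] and [0_-] abut at 0. *)
set p := nseq n true; set m := nseq n false.
have hp : hi p = 1 by apply/hi_eq1; rewrite size_nseq.
have lm : lo m = -1 by apply/lo_eqN1; rewrite size_nseq.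
by have := lo_lt_hi p; have := lo_lt_hi m; rewrite hp lm /sgn /=; lra.
Qed.

(* If x begins with - and y with +, then c x <= 0 <= c y, and equality forces
   both tails to be extreme. *)
Lemma meets_head x y : meets x y -> x 0%N = false -> y 0%N = true ->
  (forall n, x n.+1 = true) /\ (forall n, y n.+1 = false).
Proof.
move=> xy x0 y0.
suff H n : hi (mkseq (x \o S) n) = 1 /\ lo (mkseq (y \o S) n) = -1.
  split=> n; have [h l] := H n.+1.
  - have := congr1 (nth false ^~ n) ((hi_eq1 _).1 h).
    by rewrite size_mkseq nth_mkseq // nth_nseq ltnSn.
  - have := congr1 (nth true ^~ n) ((lo_eqN1 _).1 l).
    by rewrite size_mkseq nth_mkseq // nth_nseq ltnSn.
have [_] := xy n.+1; rewrite !mkseq_cons x0 y0 lo_cons hi_cons /sgn.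
have := hi_le (mkseq (x \o S) n); have := lo_ge (mkseq (y \o S) n).
by move=> *; split; lra.
Qed.

Lemma scat_zeroE b (x : nat -> sign) : x 0%N = ~~ b -> (forall n, x n.+1 = b) ->
  x = scat [::] (zero b).
Proof. by move=> x0 xS; apply/funext => -[|[|n]]; rewrite ?x0 ?xS. Qed.

Lemma meets_neq0 x y : meets x y -> x 0%N != y 0%N ->
  exists s b, x = scat s (zero b) /\ y = scat s (zero (~~ b)).
Proof.
(* The stream [zero b] begins with [~~ b], which forces this choice. *)
move=> xy nxy; exists [::], (~~ x 0%N); rewrite negbK.
case x0: (x 0%N) nxy; case y0: (y 0%N) => //= _.
- have [yS xS] := meets_head (meets_sym xy) y0 x0.
  by split; apply: scat_zeroE.
- have [xS yS] := meets_head xy x0 y0.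
  by split; apply: scat_zeroE.
Qed.

(** Common first signs are stripped until the heads differ; the stripped signs form [s]. *)
Lemma meets_neq x y n : meets x y -> x n != y n ->
  exists s b, x = scat s (zero b) /\ y = scat s (zero (~~ b)).
Proof.
elim: n x y => [|n IH] x y xy nxy; have [xy0|{}nxy] := eqVneq (x 0%N) (y 0%N).
- by rewrite xy0 eqxx in nxy.
- exact: meets_neq0.
- have [s [b [xs ys]]] := IH _ _ ((meets_tail xy0).1 xy) nxy.
  exists (x 0%N :: s), b; split; apply/funext => -[//|k].
  + exact: (congr1 (fun f : nat -> sign => f k) xs).
  + exact: (congr1 (fun f : nat -> sign => f k) ys).
- exact: meets_neq0.
Qed.

(** * Points of Cantor space *)

Lemma cyl_rcons s b : cyl (rcons s b) = omeet (cyl s) (term (size s) b).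
Proof.
rewrite /cyl size_rcons -addn1 iotaD /= -cats1 zip_cat ?size_iota //.
by rewrite bigmeet_cat /= omeetT.
Qed.

Lemma cyl_mkseq (x : nat -> sign) m n : (m <= n)%N ->
  ole (cyl (mkseq x n)) (cyl (mkseq x m)).
Proof.
move=> /subnK <-; elim: (n - m)%N => [|k IH]; first exact: ole_refl.
by rewrite addSn mkseqS cyl_rcons; exact: ole_trans (omeet_lel _ _) IH.
Qed.

Lemma cyl_mkseq_term (x : nat -> sign) n k : (n < k)%N ->
  ole (cyl (mkseq x k)) (term n (x n)).
Proof.
move=> /cyl_mkseq nk; apply: ole_trans (nk x) _.
by rewrite mkseqS cyl_rcons size_mkseq; exact: omeet_ler.
Qed.

(* The stream x, as a point of Cantor space, lies in U. *)
Definition pt (x : nat -> sign) (U : opens cantor) : Prop :=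
  exists n, ole (cyl (mkseq x n)) U.

Lemma pt_le x U V : ole U V -> pt x U -> pt x V.
Proof. by move=> UV [n nU]; exists n; exact: ole_trans UV. Qed.

Lemma streams_cyl (A : Type) (f : A -> nat -> sign) a s :
  streams f (cyl s) a <-> mkseq (f a) (size s) = s.
Proof.
elim/last_ind: s => [|s b IH]; first by rewrite cyl_nil inv_im_top.
rewrite cyl_rcons inv_im_meet /streams classify_basic -/(streams f).
rewrite size_rcons mkseqS; split.
  by move=> [/IH -> /= ->].
by move=> /rcons_inj[/IH]; split.
Qed.

(** A finite conjunction of generators constrains only a finite prefix of the stream. *)
Lemma streamsP (A : Type) (f : A -> nat -> sign) a U :
  streams f U a <-> pt (f a) U.
Proof.
split=> [|[n nU]]; last first.
  by apply: (inv_im_le (streams f) nU); apply/streams_cyl; rewrite size_mkseq.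
rewrite {1}(copenE U) inv_im_sup => -[_ [_ [l Ul <-] <-]] fl.
apply: (@pt_le _ (bigmeet (@basic _) l)).
  by rewrite [X in ole _ X](copenE U); apply: ole_sup; exists l.
elim: l {Ul} fl => [_|[k b] l IH]; first by exists 0%N; exact: ole_top.
rewrite bigmeet_cons inv_im_meet /streams classify_basic -/(streams f).
move=> [/= <- /IH[n nl]]; exists (maxn k.+1 n); apply: ole_omeet.
- by apply: cyl_mkseq_term; exact: leq_maxl.
- by apply: ole_trans nl; apply: cyl_mkseq; exact: leq_maxr.
Qed.

Lemma pt_sup x S : pt x (osup S) -> exists2 U, S U & pt x U.
Proof.
move=> /(streamsP (fun _ : unit => x) tt); rewrite inv_im_sup.
by move=> [_ [U SU <-] /streamsP xU]; exists U.
Qed.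

Lemma pt_cyl x s : pt x (cyl s) -> mkseq x (size s) = s.
Proof. by move=> /(streamsP (fun _ : unit => x) tt)/streams_cyl. Qed.

(** The inductive step for bar induction on inclusions of opens of Cantor space. *)
Lemma ole_cyl_rcons s U W :
  (forall b, ole (omeet (cyl (rcons s b)) U) W) -> ole (omeet (cyl s) U) W.
Proof.
move=> H; apply: (term_total (n := size s)) => b.
apply: ole_trans (H b); rewrite cyl_rcons -!omeetA (omeetC U).
exact: ole_refl.
Qed.

(** It suffices to treat a basic open, given by a list [l]. A stream that satisfies [l] has a prefix
    whose cylinder lies in [V]; any other stream has a prefix that contradicts an entry of [l]. *)
Lemma cantor_spatial U V : (forall x, pt x U -> pt x V) -> ole U V.
Proof.
move=> UV; rewrite (copenE U); apply/osup_le => _ [l Ul <-].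
rewrite -(omeetTl (bigmeet _ _)) -cyl_nil.
apply: (@bar_induction (fun s => ole (omeet (cyl s) (bigmeet _ l)) V)).
  by move=> s; exact: ole_cyl_rcons.
move=> x; pose xmodel (g : nat * sign) := x g.1 == g.2.
have [/allP xl|/allPn[[k b] kl xkb]] := boolP (all xmodel l).
  have [n nV] : pt x V.
    apply: UV; apply/(streamsP (fun _ : unit => x) tt).
    rewrite (copenE U) inv_im_sup; exists (streams (fun=> x) (bigmeet (@basic _) l)).
      by exists (bigmeet (@basic _) l) => //; exists l.
    rewrite inv_im_bigmeet.
    suff : @ole (discrete unit) setT
      (bigmeet (fun i => streams (fun=> x) (@basic (Theory stream_sequent) i)) l).
      by apply.
    apply/ole_bigmeet => g /xl/eqP xg [] _.
    by rewrite /streams classify_basic.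
  by exists n; exact: ole_trans (omeet_lel _ _) nV.
exists k.+1; apply: ole_trans (term_disjoint (n := k) _ xkb).
apply: omeet_mono; first exact: cyl_mkseq_term.
exact: (ole_bigmeet (@basic (Theory stream_sequent)) l _).1 (ole_refl _) _ kl.
Qed.

(** * Rational intervals and their inverse images *)

Definition itv (q r : rat) : opens interval := omeet (open_gt q) (open_lt r).

Lemma pt_gt x q : pt x (c (open_gt q)) <-> exists n, q < lo (mkseq x n).
Proof.
rewrite c_gt; split=> [/pt_sup[_ [s /= qs <-] /pt_cyl xs]|[n qn]].
- by exists (size s); rewrite xs.
- by exists n; apply: ole_sup; exists (mkseq x n).
Qed.

Lemma pt_lt x q : pt x (c (open_lt q)) <-> exists n, hi (mkseq x n) < q.
Proof.
rewrite c_lt; split=> [/pt_sup[_ [s /= qs <-] /pt_cyl xs]|[n qn]].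
- by exists (size s); rewrite xs.
- by exists n; apply: ole_sup; exists (mkseq x n).
Qed.

Lemma pt_itv x q r : pt x (c (itv q r)) <->
  exists n, q < lo (mkseq x n) /\ hi (mkseq x n) < r.
Proof.
split=> [xqr|[n [qn nr]]].
- have := pt_le (inv_im_le c (omeet_lel _ _)) xqr => /pt_gt[m qm].
  have := pt_le (inv_im_le c (omeet_ler _ _)) xqr => /pt_lt[n nr].
  exists (maxn m n); split.
  + by apply: lt_le_trans qm _; apply: lo_mkseq; exact: leq_maxl.
  + by apply: le_lt_trans nr; apply: hi_mkseq; exact: leq_maxr.
- exists n; rewrite inv_im_meet c_gt c_lt.
  by apply: ole_omeet; apply: ole_sup; exists (mkseq x n).
Qed.

Lemma meets_c x y V : meets x y -> pt x (c V) -> pt y (c V).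
Proof.
move=> xy.
pose p z := streams (fun _ : unit => z).
(* As maps from the one-point locale to the interval, the two values need only be compared on
   generators. *)
suff E : c \oL p x = c \oL p y.
  move=> /(streamsP (fun _ : unit => x) tt) xV.
  apply/(streamsP (fun _ : unit => y) tt).
  by have := congr1 (fun k : locmap _ _ => k V) E; rewrite !loccompE => <-.
have H g z z' : meets z z' -> pt z (c (@basic (Theory interval_sequent) g)) ->
    pt z' (c (@basic (Theory interval_sequent) g)).
  move=> zz'; case: g => q.
  - move=> /pt_gt[n qn]; apply/pt_gt.
    (* Cylinders of [z] and [z'] of equal depth overlap; once that of [z'] is shorter than the gap
       above [q], it lies beyond [q]. *)
    have [m Hm] : exists m, forall s, size s = m ->
        hi s - lo s < lo (mkseq z n) - q.
      by apply: small_cyl; lra.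
    have {Hm} := Hm (mkseq z' m) (size_mkseq _ _).
    have := lo_mkseq z' (leq_maxr n m); have := hi_mkseq z' (leq_maxr n m).
    have := lo_mkseq z (leq_maxl n m); have [] := zz' (maxn n m).
    by exists (maxn n m); lra.
  - move=> /pt_lt[n qn]; apply/pt_lt.
    have [m Hm] : exists m, forall s, size s = m ->
        hi s - lo s < q - hi (mkseq z n).
      by apply: small_cyl; lra.
    have {Hm} := Hm (mkseq z' m) (size_mkseq _ _).
    have := lo_mkseq z' (leq_maxr n m); have := hi_mkseq z' (leq_maxr n m).
    have := hi_mkseq z (leq_maxl n m); have [] := zz' (maxn n m).
    by exists (maxn n m); lra.
apply: locmap_classifying_ext => g; rewrite !loccompE.
apply/seteqP; split=> -[] /streamsP xg; apply/streamsP; apply: H xg => //.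
exact: meets_sym.
Qed.

Lemma open_gt_le q q' : q <= q' -> ole (open_gt q') (open_gt q).
Proof.
rewrite le_eqVlt => /predU1P[->|]; first exact: ole_refl.
exact: (cutL_mono (interval_cut (locid interval))).
Qed.

Lemma open_lt_le q q' : q <= q' -> ole (open_lt q) (open_lt q').
Proof.
rewrite le_eqVlt => /predU1P[->|]; first exact: ole_refl.
exact: (cutR_mono (interval_cut (locid interval))).
Qed.

Lemma itv_top q r : q < -1 -> 1 < r -> itv q r = otop.
Proof.
move=> q1 r1; have C := interval_cut (locid interval).
apply: ole_anti; first exact: ole_top.
apply: ole_omeet.
- apply: ole_cover (cut_loc C q1) _ => _ [->|->]; first exact: omeet_ler.
  exact: ole_trans (omeet_ler _ _) (ole_trans (cut_ge C) (osup0_le _)).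
- apply: ole_cover (cut_loc C r1) _ => _ [->|->]; last exact: omeet_ler.
  exact: ole_trans (omeet_ler _ _) (ole_trans (cut_le C) (osup0_le _)).
Qed.

Lemma bigmeet_itv (l : seq (rat + rat)) :
  exists q r, bigmeet (@basic (Theory interval_sequent)) l = itv q r.
Proof.
(* Any bounds beyond -1 and 1 serve for the empty meet. *)
elim: l => [|[p|p] l [q [r IH]]]; first by exists (-2), 2; rewrite itv_top.
- exists (Num.max p q), r; rewrite bigmeet_cons IH /itv omeetA; congr omeet.
  case: (leP p q) => pq.
  + by rewrite omeetC; apply: ole_omeetE; exact: (@open_gt_le p q).
  + by apply: ole_omeetE; apply: (@open_gt_le q p); exact: ltW.
- exists q, (Num.min p r); rewrite bigmeet_cons IH /itv omeetC -omeetA; congr omeet.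
  case: (leP p r) => pr.
  + by rewrite omeetC; apply: ole_omeetE; exact: (@open_lt_le p r).
  + by apply: ole_omeetE; apply: (@open_lt_le r p); exact: ltW.
Qed.

Lemma ole_itv (V W : opens interval) :
  (forall q r, ole (itv q r) V -> ole (itv q r) W) -> ole V W.
Proof.
move=> VW; rewrite (copenE V); apply/osup_le => _ [l Vl <-].
have [q [r lqr]] := bigmeet_itv l; rewrite lqr; apply: VW.
by rewrite -lqr [X in ole _ X](copenE V); apply: ole_sup; exists l.
Qed.

Lemma pt_c_itv x V : pt x (c V) -> exists q r,
  ole (itv q r) V /\ pt x (c (itv q r)).
Proof.
rewrite {1}(copenE V) inv_im_sup => /pt_sup[_ [_ [l Vl <-] <-]].
have [q [r lqr]] := bigmeet_itv l; rewrite lqr => xqr; exists q, r; split=> //.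
by rewrite -lqr [X in ole _ X](copenE V); apply: ole_sup; exists l.
Qed.

(** * Injectivity of the inverse image map *)

(* Bar induction on the prefixes s such that V contains an open neighbourhood
   of the closed interval [lo s, hi s]. *)
Lemma c_proper V : c V = otop -> V = otop.
Proof.
move=> cV.
suff [q [r [q1 r1 qrV]]] : exists q r,
    [/\ q < lo [::], hi [::] < r & ole (itv q r) V].
  apply: ole_anti (ole_top _) _; rewrite -(itv_top (q := q) (r := r)) //.
  - by rewrite -lo_nil.
  - by rewrite -hi_nil.
apply: (@bar_induction (fun s => exists q r,
  [/\ q < lo s, hi s < r & ole (itv q r) V])) => [s H|x].
- have [q [r' []]] := H false; have [q' [r []]] := H true.
  rewrite !lo_rcons !hi_rcons => q's sr H' qs sr' H''.
  exists q, r; split=> //.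
  (* The neighbourhoods of the two halves overlap around the midpoint, so locatedness glues them. *)
  have q'r' : q' < r' by lra.
  have C := cut_loc (interval_cut (locid interval)) q'r'.
  apply: ole_cover (ole_trans (ole_top _) C) _ => _ [->|->].
  + apply: ole_trans H'; rewrite omeetC; apply: omeet_mono (ole_refl _) _.
    exact: omeet_ler.
  + apply: ole_trans H''; apply: omeet_mono (ole_refl _); exact: omeet_lel.
- have /pt_c_itv[q [r [qrV /pt_itv[n [qn nr]]]]] : pt x (c V).
    by exists 0%N; rewrite cV; exact: ole_top.
  by exists n, q, r.
Qed.

(* Since the interval is regular, an open set is determined by the finite
   covers in which it takes part, so properness gives injectivity. *)
Lemma c_reflects_le V V' : ole (c V) (c V') -> ole V V'.
Proof.
have I := interval_cut (locid interval); have J := interval_cut c.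
move=> VV'; apply: ole_itv => q r /(inv_im_le c) qrV.
have {VV'}qrV' := ole_trans qrV VV'.
rewrite /itv; apply: ole_trans (omeet_mono (cutL_round I q) (ole_refl _)) _.
rewrite omeetC; apply: omeet_sup_le => _ [q' /= qq' <-]; rewrite omeetC.
apply: ole_trans (omeet_mono (ole_refl _) (cutR_round I r)) _.
apply: omeet_sup_le => _ [r' /= r'r <-].
(* With [q < q'] and [r' < r], the open [V'] and the two rays outside [[q', r']] cover the interval,
   because their inverse images cover Cantor space. *)
have W1 : osup [set V'; open_lt q'; open_gt r'] = otop.
  apply: c_proper; apply: ole_anti (ole_top _) _.
  apply: ole_cover (cut_loc J qq') _ => _ [->|->]; last first.
    apply: ole_trans (omeet_ler _ _) _; apply: inv_im_le.
    by apply: ole_sup; left; right.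
  rewrite omeetTl; apply: ole_cover (ole_trans (ole_top _) (cut_loc J r'r)) _.
  move=> _ [->|->].
    apply: ole_trans (omeet_ler _ _) _; apply: inv_im_le.
    by apply: ole_sup; right.
  rewrite -inv_im_meet; apply: ole_trans qrV' _; apply: inv_im_le.
  by apply: ole_sup; left; left.
apply: (@ole_cover _ _ [set V'; open_lt q'; open_gt r']).
  by rewrite W1; exact: ole_top.
move=> _ [[->|->]|->]; first exact: omeet_ler.
- apply: ole_trans (ole_trans (cut_disj I q') (osup0_le _)).
  exact: omeet_mono (omeet_lel _ _) (ole_refl _).
- apply: ole_trans (ole_trans (cut_disj I r') (osup0_le _)).
  by rewrite omeetC; exact: omeet_mono (ole_refl _) (omeet_ler _ _).
Qed.

Lemma c_inj : injective c.
Proof.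
move=> V V' E.
by apply: ole_anti; apply: c_reflects_le; rewrite E; exact: ole_refl.
Qed.

(** * The image of the inverse image map *)

Lemma cyl_gt_disjoint s q W : hi s <= q -> ole (omeet (cyl s) (c (open_gt q))) W.
Proof.
move=> sq; rewrite c_gt; apply: omeet_sup_le => _ [t /= qt <-].
by rewrite omeetC; apply: cyl_disjoint; lra.
Qed.

Lemma cyl_lt_disjoint s r W : r <= lo s -> ole (omeet (cyl s) (c (open_lt r))) W.
Proof.
move=> rs; rewrite c_lt; apply: omeet_sup_le => _ [t /= tr <-].
by apply: cyl_disjoint; lra.
Qed.

(* The bar condition holds on every stream y: either y lies in the saturated
   open U, or c y differs from c x. *)
Lemma c_nbhd U x : (forall y, meets x y -> pt y U) ->
  exists q r, pt x (c (itv q r)) /\ ole (c (itv q r)) U.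
Proof.
move=> xU.
suff [q [r [xqr]]] : exists q r, pt x (c (itv q r)) /\
    ole (omeet (cyl [::]) (c (itv q r))) U.
  by rewrite cyl_nil omeetTl; exists q, r.
apply: (@bar_induction (fun s => exists q r, pt x (c (itv q r)) /\
    ole (omeet (cyl s) (c (itv q r))) U)) => [s H|y].
- have [q [r [xqr qrU]]] := H false; have [q' [r' [xqr' qrU']]] := H true.
  move: xqr xqr' => /pt_itv[n [qn nr]] /pt_itv[n' [qn' nr']].
  have := lo_mkseq x (leq_maxl n n'); have := lo_mkseq x (leq_maxr n n').
  have := hi_mkseq x (leq_maxl n n'); have := hi_mkseq x (leq_maxr n n').
  move=> h' h l' l.
  exists (Num.max q q'), (Num.min r r'); split.
    apply/pt_itv; exists (maxn n n'); rewrite gt_max lt_min.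
    by split; apply/andP; split; lra.
  apply: ole_cyl_rcons => -[].
  + apply: ole_trans qrU'; apply: omeet_mono (ole_refl _) _; apply: inv_im_le.
    apply: omeet_mono; [apply: open_gt_le|apply: open_lt_le].
    * by rewrite le_max lexx orbT.
    * by rewrite ge_min lexx orbT.
  + apply: ole_trans qrU; apply: omeet_mono (ole_refl _) _; apply: inv_im_le.
    apply: omeet_mono; [apply: open_gt_le|apply: open_lt_le].
    * by rewrite le_max lexx.
    * by rewrite ge_min lexx.
- have [/xU[n nU]|nxy] := pselect (meets x y).
    exists n, (-2), 2; split; last exact: ole_trans (omeet_lel _ _) nU.
    by apply/pt_itv; exists 0%N; rewrite lo_nil hi_nil; lra.
  move: nxy => /existsNP[n /not_andP[|] /negP]; rewrite -ltNge => xyn.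
  (* The cylinder of [y] lies below that of [x], so its upper end separates it from [c x]; the bound
     2 imposes nothing. The other case is symmetric. *)
  + exists n, (hi (mkseq y n)), 2; split.
      by apply/pt_itv; exists n; have := hi_le (mkseq x n); lra.
    rewrite inv_im_meet omeetA; apply: ole_trans (omeet_lel _ _) _.
    exact: cyl_gt_disjoint.
  + exists n, (-2), (lo (mkseq y n)); split.
      by apply/pt_itv; exists n; have := lo_ge (mkseq x n); lra.
    rewrite inv_im_meet (omeetC (c _)) omeetA; apply: ole_trans (omeet_lel _ _) _.
    exact: cyl_lt_disjoint.
Qed.

Lemma c_image U : u_plus U = u_minus U -> exists V, c V = U.
Proof.
move=> uU; have ptU s b : pt (scat s (zero b)) U -> pt (scat s (zero (~~ b))) U.
  move=> /(streamsP (fun s => scat s (zero b)) s) sU.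
  apply/(streamsP (fun s => scat s (zero (~~ b))) s).
  by have <- : u b U = u (~~ b) U by case: b {sU}.
have satU x y : meets x y -> pt x U -> pt y U.
  move=> xy xU; have [[n nxy]|xyE] := pselect (exists n, x n != y n).
    have [s [b [xE ->]]] := meets_neq xy nxy.
    by apply: ptU; rewrite -xE.
  suff <- : x = y by [].
  apply/funext => n; apply/eqP; apply: contrapT => /negP nxy.
  by apply: xyE; exists n.
(* The witness is the largest open whose inverse image lies in [U]; [c_nbhd] shows that its inverse
   image contains every point of [U]. *)
exists (osup [set V | ole (c V) U]); apply: ole_anti.
  by rewrite inv_im_sup; apply/osup_le => _ [V VU <-].
apply: cantor_spatial => x xU.
have [q [r [xqr qrU]]] := c_nbhd (fun y xy => satU _ _ xy xU).
by apply: pt_le xqr; apply: inv_im_le; exact: ole_sup.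
Qed.

(** * The coequalizer *)

Lemma c_u : c \oL u_plus = c \oL u_minus.
Proof.
apply: locmap_ext => V; rewrite !loccompE.
apply/seteqP; split=> s /streamsP sV; apply/streamsP; apply: meets_c sV.
- exact: meets_zero.
- exact/meets_sym/meets_zero.
Qed.

Theorem theorem7p6 : is_coequalizer u_plus u_minus c.
Proof.
exact: coequalizer_of_frame_equalizer c_u c_inj c_image.
Qed.
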